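(* The category $\omega\mathbf{EM}$ of $\omega$-effect monoids and $\omega$-normal effect monoid homomorphisms is equivalent to the Eilenberg-Moore category of some monad over the category $\mathbf{BPos}$ of bounded posets.
   Context: **Bounded posets.** A poset is bounded when it has a minimum $0$ and a maximum $1$. $\mathbf{BPos}$ is the category of bounded posets and order-preserving maps preserving $0$ and $1$. A bounded poset is $\omega$-complete when every increasing sequence $a_1\leq a_2\leq\cdots$ has a supremum. A monotone map $f$ between $\omega$-complete bounded posets is $\omega$-normal when $f(\bigvee_i x_i)=\bigvee_i f(x_i)$ for every increasing sequence $x_1\leq x_2\leq\cdots$. **Effect algebras.** An effect algebra is a set $E$ with an element $0$, a partial binary operation $\oplus$ and a total unary operation $(\ )^\perp$ such that, writing $a\perp b$ when $a\oplus b$ is defined and $1:=0^\perp$: (i) if $a\perp b$ then $b\perp a$ and $a\oplus b=b\oplus a$; (ii) $a\perp 0$ and $a\oplus 0=a$; (iii) if $a\perp b$ and $(a\oplus b)\perp c$ then $b\perp c$, $a\perp(b\oplus c)$ and $(a\oplus b)\oplus c=a\oplus(b\oplus c)$; (iv) $a^\perp$ is the unique element with $a\oplus a^\perp=1$; (v) if $a\perp 1$ then $a=0$. It is a bounded poset under $a\leq b$ iff $a\oplus c=b$ for some $c$. A homomorphism is a map $f$ with $f(1)=1$ such that $a\perp b$ implies $f(a)\perp f(b)$ and $f(a\oplus b)=f(a)\oplus f(b)$. **Effect monoids.** An effect monoid is an effect algebra $M$ with a total binary operation $\cdot$ that is associative, satisfies $x\cdot 1=x=1\cdot x$, and is such that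 $y\perp z$ implies $x\cdot y\perp x\cdot z$, $y\cdot x\perp z\cdot x$, $x\cdot(y\oplus z)=(x\cdot y)\oplus(x\cdot z)$ and $(y\oplus z)\cdot x=(y\cdot x)\oplus(z\cdot x)$. An $\omega$-effect monoid is an effect monoid whose underlying bounded poset is $\omega$-complete. The category $\omega\mathbf{EM}$ has $\omega$-effect monoids as objects and, as morphisms, effect algebra homomorphisms that are $\omega$-normal and preserve the product operation, $f(a\cdot b)=f(a)\cdot f(b)$. *)

(* Defs.v *)
From HB Require Import structures.
From mathcomp Require Import all_boot all_order.
From mathcomp Require Import boolp classical_sets.

Set Implicit Arguments.
Unset Strict Implicit.
Unset Printing Implicit Defensive.

Local Open Scope classical_set_scope.
Local Open Scope order_scope.

Import Order.TTheory.

Declare Scope cat_scope.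
Delimit Scope cat_scope with cat.
Local Open Scope cat_scope.

Record category := Category {
  obj :> Type;
  hom : obj -> obj -> Type;
  idm : forall a, hom a a;
  comp : forall a b c, hom b c -> hom a b -> hom a c;
  comp1m : forall a b (f : hom a b), comp (idm b) f = f;
  compm1 : forall a b (f : hom a b), comp f (idm a) = f;
  compA : forall a b c d (h : hom c d) (g : hom b c) (f : hom a b),
    comp h (comp g f) = comp (comp h g) f }.

Arguments hom {c0} a b : rename.
Arguments idm {c0} a : rename.
Arguments comp {c0 a b c} g f : rename.

Notation "g ∘ f" := (comp g f) (at level 40, left associativity) : cat_scope.

Record functor (C D : category) := Functor {
  fobj :> C -> D;
  fmap : forall a b : C, hom a b -> hom (fobj a) (fobj b);
  fmap1 : forall a, fmap (idm a) = idm (fobj a);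
  fmapM : forall (a b c : C) (g : hom b c) (f : hom a b),
    fmap (g ∘ f) = fmap g ∘ fmap f }.

Arguments fmap {C D} f0 {a b} f : rename.

Definition functor_id (C : category) : functor C C :=
  @Functor C C id (fun _ _ f => f) (fun _ => erefl) (fun _ _ _ _ _ => erefl).

Lemma functor_comp1 (C D E : category) (G : functor D E) (F : functor C D) a :
  fmap G (fmap F (idm a)) = idm (G (F a)).
Proof. by rewrite !fmap1. Qed.

Lemma functor_compM (C D E : category) (G : functor D E) (F : functor C D)
    (a b c : C) (g : hom b c) (f : hom a b) :
  fmap G (fmap F (g ∘ f)) = fmap G (fmap F g) ∘ fmap G (fmap F f).
Proof. by rewrite !fmapM. Qed.

Definition functor_comp (C D E : category) (G : functor D E) (F : functor C D) :
    functor C E :=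
  @Functor C E (fun a => G (F a)) (fun _ _ f => fmap G (fmap F f))
    (functor_comp1 G F) (functor_compM G F).

Record nattrans (C D : category) (F G : functor C D) := NatTrans {
  ntcomp :> forall a, hom (F a) (G a);
  ntnat : forall (a b : C) (f : hom a b),
    ntcomp b ∘ fmap F f = fmap G f ∘ ntcomp a }.

Definition is_iso (C : category) (a b : C) (f : hom a b) : Prop :=
  exists g : hom b a, g ∘ f = idm a /\ f ∘ g = idm b.

Definition naturally_isomorphic (C D : category) (F G : functor C D) : Prop :=
  exists t : nattrans F G, forall a, is_iso (t a).

Definition equivalent (C D : category) : Prop :=
  exists (F : functor C D) (G : functor D C),
    naturally_isomorphic (functor_comp G F) (functor_id C) /\
    naturally_isomorphic (functor_comp F G) (functor_id D).

Record monad (C : category) := Monad {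
  mfun :> functor C C;
  munit : nattrans (functor_id C) mfun;
  mmult : nattrans (functor_comp mfun mfun) mfun;
  munitl : forall a, mmult a ∘ munit (mfun a) = idm (mfun a);
  munitr : forall a, mmult a ∘ fmap mfun (munit a) = idm (mfun a);
  mmultA : forall a, mmult a ∘ fmap mfun (mmult a) = mmult a ∘ mmult (mfun a) }.

Section EilenbergMoore.
Variables (C : category) (T : monad C).

Record em_algebra := EMAlgebra {
  em_car : C;
  em_str : hom (T em_car) em_car;
  em_unit : em_str ∘ munit T em_car = idm em_car;
  em_mult : em_str ∘ fmap T em_str = em_str ∘ mmult T em_car }.

Record em_hom (A B : em_algebra) := EMHom {
  em_mor : hom (em_car A) (em_car B);
  em_morP : em_mor ∘ em_str A = em_str B ∘ fmap T em_mor }.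

Lemma em_hom_eq A B (f g : em_hom A B) : em_mor f = em_mor g -> f = g.
Proof.
by case: f g => [f fP] [g gP] /= e; subst g; rewrite (Prop_irrelevance fP gP).
Qed.

Lemma em_idP A : idm (em_car A) ∘ em_str A = em_str A ∘ fmap T (idm (em_car A)).
Proof. by rewrite fmap1 comp1m compm1. Qed.

Lemma em_compP A B D (g : em_hom B D) (f : em_hom A B) :
  (em_mor g ∘ em_mor f) ∘ em_str A = em_str D ∘ fmap T (em_mor g ∘ em_mor f).
Proof. by rewrite fmapM -compA em_morP !compA em_morP. Qed.

Definition em_id A : em_hom A A := EMHom (em_idP A).
Definition em_comp A B D (g : em_hom B D) (f : em_hom A B) : em_hom A D :=
  EMHom (em_compP g f).

Definition EilenbergMoore : category.
Proof.
refine (@Category em_algebra em_hom em_id em_comp _ _ _).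
- by move=> A B f; apply: em_hom_eq; exact: comp1m.
- by move=> A B f; apply: em_hom_eq; exact: compm1.
- by move=> A B D E h g f; apply: em_hom_eq; exact: compA.
Defined.

End EilenbergMoore.

(* Displays carry no mathematical content, so one is fixed. *)
Definition bpos_display : Order.disp_t := Order.Disp tt tt.

Notation bposType := (tbPOrderType bpos_display).

Record bpos_hom (P Q : bposType) := BPosHom {
  bpos_fun :> P -> Q;
  bpos_homo : {homo bpos_fun : x y / x <= y};
  bpos_bot : bpos_fun \bot = \bot;
  bpos_top : bpos_fun \top = \top }.

Lemma bpos_hom_eq P Q (f g : bpos_hom P Q) : bpos_fun f = bpos_fun g -> f = g.
Proof.
case: f g => [f f1 f2 f3] [g g1 g2 g3] /= e; subst g.
by rewrite (Prop_irrelevance f1 g1) (Prop_irrelevance f2 g2)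
  (Prop_irrelevance f3 g3).
Qed.

Definition bpos_id (P : bposType) : bpos_hom P P.
Proof. by exists id. Defined.

Definition bpos_comp (P Q S : bposType) (g : bpos_hom Q S) (f : bpos_hom P Q) :
  bpos_hom P S.
Proof.
exists (g \o f).
- by move=> x y /(bpos_homo f) /(bpos_homo g).
- by rewrite /= !bpos_bot.
- by rewrite /= !bpos_top.
Defined.

Definition BPos : category.
Proof.
refine (@Category bposType bpos_hom bpos_id bpos_comp _ _ _).
all: by move=> *; exact: bpos_hom_eq.
Defined.

Definition increasing_seq (P : bposType) (x : nat -> P) : Prop :=
  {homo x : m n / (m <= n)%N >-> m <= n}.

Definition omega_complete (P : bposType) : Prop :=
  forall x : nat -> P, increasing_seq x -> supremums (range x) !=set0.

Definition omega_normal (P Q : bposType) (f : P -> Q) : Prop :=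
  forall (x : nat -> P) (s : P), increasing_seq x ->
    supremums (range x) s -> supremums (range (f \o x)) (f s).

(* [oplus a b = None] means that the partial sum of [a] and [b] is undefined.
   The unit is [orth ezero]. *)
HB.mixin Record isEffectAlgebra (E : Type) := {
  ezero : E;
  oplus : E -> E -> option E;
  orth : E -> E;
  oplusC : forall a b c, oplus a b = Some c -> oplus b a = Some c;
  oplus0 : forall a, oplus a ezero = Some a;
  oplusA : forall a b c ab abc, oplus a b = Some ab -> oplus ab c = Some abc ->
    exists2 bc, oplus b c = Some bc & oplus a bc = Some abc;
  oplus_orth : forall a, oplus a (orth a) = Some (orth ezero);
  orth_uniq : forall a b, oplus a b = Some (orth ezero) -> b = orth a;
  oplus1 : forall a, oplus a (orth ezero) -> a = ezero }.

#[short(type="effectAlgebraType")]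
HB.structure Definition EffectAlgebra := {E of isEffectAlgebra E}.

Arguments oplusC {E a b c} : rename.
Arguments oplusA {E a b c ab abc} : rename.
Arguments orth_uniq {E a b} : rename.
Arguments oplus1 {E a} : rename.

Definition eone {E : effectAlgebraType} : E := orth ezero.

Definition ele (E : effectAlgebraType) (a b : E) : Prop :=
  exists c, oplus a c = Some b.

Section EffectAlgebraOrder.
Variable E : effectAlgebraType.
Implicit Types a b c : E.

Lemma orthK a : orth (orth a) = a.
Proof. by apply/esym/orth_uniq/oplusC/oplus_orth. Qed.

Lemma oplus_eq0 a b : oplus a b = Some ezero -> a = ezero.
Proof.
move=> ab.
have h : oplus ezero (orth ezero) = Some (orth ezero :> E) by exact: oplus_orth.
have [c bc ac] := oplusA ab h.
have c1 : c = orth a by exact: orth_uniq ac.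
have b0 : b = ezero by apply: oplus1; rewrite bc.
by move: ab; rewrite b0 oplus0 => -[].
Qed.

Lemma oplus_idr a b : oplus a b = Some a -> b = ezero.
Proof.
move=> /oplusC ba; have [c ac bc] := oplusA ba (oplus_orth a).
by apply: oplus1; move: ac bc; rewrite oplus_orth => -[<-] ->.
Qed.

Lemma ele_refl a : ele a a.
Proof. by exists ezero; exact: oplus0. Qed.

Lemma ele_trans a b c : ele a b -> ele b c -> ele a c.
Proof. by move=> [x ax] [y bY]; have [z _ az] := oplusA ax bY; exists z. Qed.

Lemma ele_anti a b : ele a b -> ele b a -> a = b.
Proof.
move=> [x ax] [y bY]; have [z xy az] := oplusA ax bY.
have x0 : x = ezero by apply: (@oplus_eq0 x y); rewrite xy (oplus_idr az).
by move: ax; rewrite x0 oplus0 => -[].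
Qed.

Lemma ele0 a : ele ezero a.
Proof. by exists a; exact/oplusC/oplus0. Qed.

Lemma ele1 a : ele a eone.
Proof. by exists (orth a); exact: oplus_orth. Qed.

End EffectAlgebraOrder.

(* An alias of [E] carrying its order as an effect algebra. *)
Definition ea_poset (E : effectAlgebraType) : Type := E.

Section EffectAlgebraPoset.
Variable E : effectAlgebraType.

Definition ea_leb (a b : ea_poset E) : bool := `[< @ele E a b >].

Lemma ea_leb_refl : reflexive ea_leb.
Proof. by move=> a; apply/asboolP/ele_refl. Qed.

Lemma ea_leb_anti : antisymmetric ea_leb.
Proof. by move=> a b /andP[/asboolP ab /asboolP ba]; exact: ele_anti. Qed.

Lemma ea_leb_trans : transitive ea_leb.
Proof.
by move=> b a c /asboolP ab /asboolP bc; apply/asboolP; exact: ele_trans bc.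
Qed.

HB.instance Definition _ := gen_eqMixin (ea_poset E).
HB.instance Definition _ := gen_choiceMixin (ea_poset E).
HB.instance Definition _ := Order.Le_isPOrder.Build bpos_display (ea_poset E)
  ea_leb_refl ea_leb_anti ea_leb_trans.

Lemma ea_bottom (a : ea_poset E) : ((ezero : E) : ea_poset E) <= a.
Proof. by apply/asboolP/ele0. Qed.

Lemma ea_top (a : ea_poset E) : a <= ((eone : E) : ea_poset E).
Proof. by apply/asboolP/ele1. Qed.

HB.instance Definition _ :=
  Order.hasBottom.Build bpos_display (ea_poset E) ea_bottom.
HB.instance Definition _ :=
  Order.hasTop.Build bpos_display (ea_poset E) ea_top.

End EffectAlgebraPoset.

HB.mixin Record EffectAlgebra_isEffectMonoid M of EffectAlgebra M := {
  emul : M -> M -> M;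
  emulA : forall x y z, emul x (emul y z) = emul (emul x y) z;
  emulr1 : forall x, emul x eone = x;
  emul1r : forall x, emul eone x = x;
  emulDr : forall x y z s, oplus y z = Some s ->
    oplus (emul x y) (emul x z) = Some (emul x s);
  emulDl : forall x y z s, oplus y z = Some s ->
    oplus (emul y x) (emul z x) = Some (emul s x) }.

#[short(type="effectMonoidType")]
HB.structure Definition EffectMonoid :=
  {M of EffectAlgebra_isEffectMonoid M & EffectAlgebra M}.

Arguments emulDr {M} x {y z s} : rename.
Arguments emulDl {M} x {y z s} : rename.

HB.mixin Record EffectMonoid_isOmega M of EffectMonoid M := {
  ea_omega_complete : omega_complete (ea_poset M) }.

#[short(type="omegaEffectMonoidType")]
HB.structure Definition OmegaEffectMonoid :=
  {M of EffectMonoid_isOmega M & EffectMonoid M}.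

Record oem_hom (M N : omegaEffectMonoidType) := OEMHom {
  oem_fun :> M -> N;
  oem_one : oem_fun eone = eone;
  oem_oplus : forall a b c, oplus a b = Some c ->
    oplus (oem_fun a) (oem_fun b) = Some (oem_fun c);
  oem_normal : @omega_normal (ea_poset M) (ea_poset N) oem_fun;
  oem_mul : {morph oem_fun : a b / emul a b} }.

Arguments oem_one {M N} _.
Arguments oem_oplus {M N} _ {a b c} _.
Arguments oem_normal {M N} _ [x s] _ _.
Arguments oem_mul {M N} _ _ _.

Lemma oem_hom_eq M N (f g : oem_hom M N) : oem_fun f = oem_fun g -> f = g.
Proof.
case: f g => [f f1 f2 f3 f4] [g g1 g2 g3 g4] /= e; subst g.
by rewrite (Prop_irrelevance f1 g1) (Prop_irrelevance f2 g2)
  (Prop_irrelevance f3 g3) (Prop_irrelevance f4 g4).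
Qed.

Lemma oem_homo M N (f : oem_hom M N) :
  {homo (f : ea_poset M -> ea_poset N) : x y / x <= y}.
Proof.
by move=> x y /asboolP[c xc]; apply/asboolP; exists (f c); exact: oem_oplus.
Qed.

Definition oem_id (M : omegaEffectMonoidType) : oem_hom M M.
Proof. by exists id. Defined.

Definition oem_comp (M N L : omegaEffectMonoidType)
    (g : oem_hom N L) (f : oem_hom M N) : oem_hom M L.
Proof.
exists (g \o f).
- by rewrite /= !oem_one.
- by move=> a b c abc; do 2!apply: oem_oplus.
- move=> x s xI xs; have fs := oem_normal f xI xs.
  have fI : increasing_seq ((f : ea_poset M -> ea_poset N) \o x).
    by move=> m n mn; apply/oem_homo/xI.
  exact: (oem_normal g fI fs).
- by move=> a b; rewrite /= !oem_mul.
Defined.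

Definition omegaEM : category.
Proof.
refine (@Category omegaEffectMonoidType oem_hom oem_id oem_comp _ _ _).
all: by move=> *; exact: oem_hom_eq.
Defined.

(* Main.v *)
From HB Require Import structures.
From mathcomp Require Import all_boot all_order generic_quotient.
From mathcomp Require Import boolp classical_sets.
Require Import Defs.

Set Implicit Arguments.
Unset Strict Implicit.
Unset Printing Implicit Defensive.

(** The proof exhibits the forgetful functor [underlying] from omega-effect
    monoids to bounded posets as monadic.

    It has a left adjoint. The free omega-effect monoid on a bounded poset [P]
    consists of the formal terms over [P] that can be evaluated along every map
    from [P] to an omega-effect monoid, two terms being identified when they
    always have the same value. Everything in [free P] is then decided
    pointwise: order, sums, products and suprema of increasing sequences are
    those of the values. The evaluations range over a class of omega-effect
    monoids that contains [free P] itself; this is harmless because it only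
    occurs in propositions, and it is what makes the extension of a map to
    [free P] unique ([free_ext_uniq]).

    Monadicity comes from the shape of the operations. Product and
    orthosupplement are total, suprema are taken of increasing sequences, and
    the partial sum can be recovered from the difference of [a <= c], the [b]
    such that [a] plus [b] is [c]. These domains are order conditions, so they
    are respected by every monotone map. Hence an operation can be carried
    along a split coequalizer [h : B -> P] of bounded posets, with section [s],
    by applying it in [B] to the images under [s] and projecting with [h]
    (section SplitQuotient). The structure map of an algebra over the monad is
    such a split coequalizer, so the carrier of every algebra becomes an
    omega-effect monoid ([algebra_structure]). The same argument with only a
    section shows that a monotone map out of [M] is a homomorphism as soon as
    its composite with a split surjective homomorphism onto [M] is one
    ([underlying_lift]), hence that algebra morphisms are homomorphisms. These
    two facts, with faithfulness, make the comparison functor an equivalence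
    ([monadicity]). *)

Import Order.TTheory.

Local Open Scope classical_set_scope.
Local Open Scope order_scope.
Local Open Scope cat_scope.

(** * A monadicity criterion *)

(** Only the existence of inverse data is assumed, so the inverse functor is
    obtained by choosing preimages of objects and of morphisms; faithfulness
    makes the choice on morphisms functorial. *)
Lemma equivalent_ff_es (C D : category) (K : functor C D) :
    (forall a b (f g : hom a b), fmap K f = fmap K g -> f = g) ->
    (forall a b (m : hom (K a) (K b)), exists f : hom a b, fmap K f = m) ->
    (forall d : D, exists c (i : hom (K c) d), is_iso i) ->
  equivalent C D.
Proof.
move=> faith full es.
have [L HL] := choice es.
pose i d := sval (cid (HL d)).
have Hi d : is_iso (i d) := svalP (cid (HL d)).
pose j d := sval (cid (Hi d)).
have Hj d : j d ∘ i d = idm _ /\ i d ∘ j d = idm _ := svalP (cid (Hi d)).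
have ji d : j d ∘ i d = idm _ by case: (Hj d).
have ij d : i d ∘ j d = idm _ by case: (Hj d).
have Kpre a b (m : hom (K a) (K b)) := cid (full a b m).
pose pre a b (m : hom (K a) (K b)) := sval (Kpre a b m).
have preK a b (m : hom (K a) (K b)) : fmap K (pre a b m) = m.
  by rewrite /pre; case: (Kpre a b m).
pose Lmap a b (m : hom a b) := pre _ _ (j b ∘ m ∘ i a).
have LmapK a b (m : hom a b) : fmap K (Lmap a b m) = j b ∘ m ∘ i a.
  exact: preK.
have L1 a : Lmap a a (idm a) = idm (L a).
  by apply: faith; rewrite LmapK fmap1 compm1 ji.
have LM a b c (g : hom b c) (f : hom a b) :
    Lmap a c (g ∘ f) = Lmap b c g ∘ Lmap a b f.
  apply: faith; rewrite fmapM !LmapK.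
  by rewrite -!compA (compA (i b)) ij comp1m.
pose LF : functor D C := Functor L1 LM.
exists K, LF; split.
- have natP a b (f : hom a b) :
      pre _ _ (i (K b)) ∘ fmap (functor_comp LF K) f =
      fmap (functor_id C) f ∘ pre _ _ (i (K a)).
    apply: faith; rewrite !fmapM !preK /=.
    by rewrite -!compA compA ij comp1m.
  exists (NatTrans (F := functor_comp LF K) (G := functor_id C) natP) => a /=.
  exists (pre _ _ (j (K a))); split; apply: faith.
    by rewrite fmapM !preK fmap1 ji.
  by rewrite fmapM !preK fmap1 ij.
- have natP a b (f : hom a b) :
      i b ∘ fmap (functor_comp K LF) f = fmap (functor_id D) f ∘ i a.
    by rewrite /= preK -!compA compA ij comp1m.
  exists (NatTrans (F := functor_comp K LF) (G := functor_id D) natP) => d /=.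
  by exists (j d).
Qed.

(** The left adjoint of [U] is given by universal arrows: [eta P] from [P] to
    [U (F P)], with [ext f] the extension of [f] along [eta P]. *)
Section Monadicity.
Variables (C D : category) (U : functor D C) (F : C -> D).
Variable eta : forall P, hom P (U (F P)).
Variable ext : forall P M, hom P (U M) -> hom (F P) M.
Hypothesis extK : forall P M (f : hom P (U M)), fmap U (ext f) ∘ eta P = f.
Hypothesis ext_inj : forall P M (g h : hom (F P) M),
  fmap U g ∘ eta P = fmap U h ∘ eta P -> g = h.

Definition free_map P Q (f : hom P Q) : hom (F P) (F Q) := ext (eta Q ∘ f).

Lemma free_map1 P : free_map (idm P) = idm (F P).
Proof. by apply: ext_inj; rewrite extK compm1 fmap1 comp1m. Qed.

Lemma free_mapM P Q S (g : hom Q S) (f : hom P Q) :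
  free_map (g ∘ f) = free_map g ∘ free_map f.
Proof.
by apply: ext_inj; rewrite fmapM -compA !extK !compA extK.
Qed.

Definition free_functor : functor C D := Functor free_map1 free_mapM.

Definition counit M : hom (F (U M)) M := ext (idm (U M)).

Lemma counit_eta M : fmap U (counit M) ∘ eta (U M) = idm (U M).
Proof. exact: extK. Qed.

Lemma counit_nat M N (k : hom M N) :
  counit N ∘ free_map (fmap U k) = k ∘ counit M.
Proof.
by apply: ext_inj; rewrite !fmapM -!compA !extK compA extK comp1m compm1.
Qed.

Lemma eta_nat P Q (f : hom P Q) :
  eta Q ∘ fmap (functor_id C) f =
  fmap (functor_comp U free_functor) f ∘ eta P.
Proof. by rewrite /= extK. Qed.

Definition free_unit : nattrans (functor_id C) (functor_comp U free_functor) :=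
  NatTrans (F := functor_id C) (G := functor_comp U free_functor) eta_nat.

Let T := functor_comp U free_functor.

Lemma free_mult_nat P Q (f : hom P Q) :
  fmap U (counit (F Q)) ∘ fmap (functor_comp T T) f =
  fmap T f ∘ fmap U (counit (F P)).
Proof. by rewrite /= -!fmapM counit_nat. Qed.

Definition free_mult : nattrans (functor_comp T T) T :=
  NatTrans (F := functor_comp T T) (G := T) free_mult_nat.

Lemma free_munitl P :
  free_mult P ∘ free_unit (T P) = idm (T P).
Proof. exact: extK. Qed.

Lemma free_munitr P :
  free_mult P ∘ fmap T (free_unit P) = idm (T P).
Proof.
rewrite /= -fmapM -fmap1; congr fmap; apply: ext_inj.
by rewrite fmapM -compA extK compA extK fmap1.
Qed.

Lemma free_mmultA P :
  free_mult P ∘ fmap T (free_mult P) = free_mult P ∘ free_mult (T P).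
Proof. by rewrite /= -!fmapM counit_nat. Qed.

Definition free_monad : monad C :=
  Monad free_munitl free_munitr free_mmultA.

Lemma counit_assoc M :
  fmap U (counit M) ∘ fmap free_monad (fmap U (counit M)) =
  fmap U (counit M) ∘ mmult free_monad (U M).
Proof. by rewrite /= -!fmapM counit_nat. Qed.

Definition comparison_obj (M : D) : EilenbergMoore free_monad :=
  @EMAlgebra C free_monad (U M) (fmap U (counit M)) (counit_eta M)
    (counit_assoc M).

Lemma comparison_homP M N (k : hom M N) :
  fmap U k ∘ em_str (comparison_obj M) =
  em_str (comparison_obj N) ∘ fmap free_monad (fmap U k).
Proof. by rewrite /= -!fmapM counit_nat. Qed.

Definition comparison_map M N (k : hom M N) :
    hom (comparison_obj M) (comparison_obj N) :=
  @EMHom C free_monad (comparison_obj M) (comparison_obj N) (fmap U k)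
    (comparison_homP k).

Lemma comparison_map1 M : comparison_map (idm M) = idm (comparison_obj M).
Proof. by apply: em_hom_eq; rewrite /= fmap1. Qed.

Lemma comparison_mapM M N L (g : hom N L) (f : hom M N) :
  comparison_map (g ∘ f) = comparison_map g ∘ comparison_map f.
Proof. by apply: em_hom_eq; rewrite /= fmapM. Qed.

Definition comparison : functor D (EilenbergMoore free_monad) :=
  Functor comparison_map1 comparison_mapM.

(** These conditions replace those of Beck's theorem on split pairs: [U_lift]
    says that a morphism [h] of [D] whose image is a split epimorphism detects
    the morphisms out of its codomain, and [U_algebra] that every structure map
    is, up to isomorphism, the image of a morphism of [D]. *)
Hypothesis U_faithful : forall M N (g h : hom M N),
  fmap U g = fmap U h -> g = h.
Hypothesis U_lift : forall B M N (h : hom B M) (s : hom (U M) (U B))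
    (k : hom (U M) (U N)) (l : hom B N),
  fmap U h ∘ s = idm (U M) -> k ∘ fmap U h = fmap U l ->
  exists k', fmap U k' = k.
Hypothesis U_algebra : forall A : em_algebra free_monad,
  exists (M : D) (q : hom (F (em_car A)) M) (i : hom (U M) (em_car A)),
    is_iso i /\ i ∘ fmap U q = em_str A.

(** The structure map [fmap U (counit M)] of a comparison algebra is split by
    [eta (U M)], which brings algebra morphisms under [U_lift]. *)
Lemma comparison_full M N (m : hom (comparison M) (comparison N)) :
  exists k : hom M N, fmap comparison k = m.
Proof.
have [|k Uk] := @U_lift _ _ _ (counit M) _ (em_mor m)
  (counit N ∘ free_map (em_mor m)) (counit_eta M).
  by rewrite fmapM (em_morP m).
by exists k; apply: em_hom_eq.
Qed.

(** Once [U M] is identified with the carrier of [A] along [i], the quotient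
    map [q] and the counit of [M] agree on generators; so the structure map of
    [A] is the one coming from [M]. *)
Lemma comparison_es (A : EilenbergMoore free_monad) :
  exists (M : D) (i : hom (comparison M) A), is_iso i.
Proof.
have [M [q [i [[j [ji ij]] iq]]]] := U_algebra A.
have qE : q ∘ free_map i = counit M.
  apply: ext_inj; rewrite counit_eta fmapM -compA extK compA.
  have -> : fmap U q = j ∘ em_str A by rewrite -iq compA ji comp1m.
  by rewrite -(compA j) (em_unit A) compm1 ji.
have iP : i ∘ em_str (comparison M) = em_str A ∘ fmap free_monad i.
  by rewrite /= -qE fmapM compA iq.
have jP : j ∘ em_str A = em_str (comparison M) ∘ fmap free_monad j.
  rewrite -[em_str A]compm1 -fmap1 -ij fmapM (compA (em_str A)) -iP.
  by rewrite !compA ji comp1m.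
exists M, (@EMHom _ _ (comparison M) A i iP).
by exists (@EMHom _ _ A (comparison M) j jP); split; apply: em_hom_eq.
Qed.

Theorem monadicity : equivalent D (EilenbergMoore free_monad).
Proof.
apply: (@equivalent_ff_es _ _ comparison).
- by move=> M N f g /(congr1 (fun m => em_mor m)); exact: U_faithful.
- exact: comparison_full.
- exact: comparison_es.
Qed.

End Monadicity.

(** * Effect algebras and their forgetful functor *)

Section EffectAlgebraFacts.
Variable E : effectAlgebraType.
Implicit Types a b c d : E.

(** The three elements [a], [b] and [orth c] play symmetric roles: each of them
    is orthogonal to the sum of the other two, and they add up to [eone]. *)
Lemma oplus_orth_sum a b c :
  oplus a b = Some c -> oplus a (orth c) = Some (orth b).
Proof.
move=> ab; have [d bd ad] := oplusA (oplusC ab) (oplus_orth c).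
by rewrite bd (orth_uniq ad).
Qed.

Lemma oplus_cancel a b b' c :
  oplus a b = Some c -> oplus a b' = Some c -> b = b'.
Proof.
move=> /oplus_orth_sum ab /oplus_orth_sum; rewrite ab => -[e].
by rewrite -[b]orthK e orthK.
Qed.

Lemma ea_leP a b : reflect (exists c, oplus a c = Some b)
  ((a : ea_poset E) <= (b : ea_poset E)).
Proof. exact: asboolP. Qed.

End EffectAlgebraFacts.

Lemma supremum_uniq (P : bposType) (A : set P) x y :
  supremums A x -> supremums A y -> x = y.
Proof.
by move=> [xu xl] [yu yl]; apply/le_anti/andP; split; [apply: xl|apply: yl].
Qed.

Lemma supremum_rangeP (P : bposType) (x : nat -> P) s :
  supremums (range x) s <->
  (forall i, x i <= s) /\ (forall u, (forall i, x i <= u) -> s <= u).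
Proof.
split=> -[h1 h2]; split.
- by move=> i; apply: h1; exists i.
- by move=> u hu; apply: h2 => _ [i _ <-].
- by move=> _ [i _ <-].
- by move=> u hu; apply: h2 => i; apply: hu; exists i.
Qed.

Lemma oem_zero (M N : omegaEffectMonoidType) (g : oem_hom M N) :
  g ezero = ezero.
Proof.
by have := oem_oplus g (oplus0 (ezero : M)); exact: oplus_idr.
Qed.

Lemma oem_orth (M N : omegaEffectMonoidType) (g : oem_hom M N) a :
  g (orth a) = orth (g a).
Proof.
apply: orth_uniq; rewrite -[orth ezero](oem_one g).
exact/oem_oplus/oplus_orth.
Qed.

Definition underlying_obj (M : omegaEM) : BPos := ea_poset M.

Definition underlying_map (M N : omegaEM) (g : hom M N) :
  hom (underlying_obj M) (underlying_obj N) :=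
  @BPosHom (ea_poset M) (ea_poset N) (oem_fun g) (oem_homo g) (oem_zero g)
    (oem_one g).

Definition underlying : functor omegaEM BPos.
Proof.
refine (@Functor omegaEM BPos underlying_obj underlying_map _ _).
  by move=> M; exact: bpos_hom_eq.
by move=> M N L g f; exact: bpos_hom_eq.
Defined.

(** * Homomorphisms out of a split quotient *)

(** Each operation of [M] can be computed in [B] on the images under [s] and
    then projected by [h]; as [k \o h] is the homomorphism [l], the map [k]
    preserves it. Partial sums pass through [s] because a sum of [a] and [b]
    being [c] is the inequality [a <= c] together with the value of a
    difference, which cancellation makes unique. *)
Section Lift.
Variables (B M N : omegaEffectMonoidType) (h : oem_hom B M) (l : oem_hom B N).
Variables (s : bpos_hom (ea_poset M) (ea_poset B)).
Variable k : bpos_hom (ea_poset M) (ea_poset N).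
Hypothesis hs : forall x : M, h (s x) = x.
Hypothesis kh : forall b : B, k (h b) = l b.

Lemma lift_oplus a b c : oplus a b = Some c ->
  oplus (k a : N) (k b : N) = Some (k c : N).
Proof.
move=> ab; have /ea_leP[d sd] : s a <= s c by apply/bpos_homo/ea_leP; exists b.
have /(oplus_cancel ab) -> : oplus a (h d) = Some c.
  by rewrite -{1}[a]hs -[c]hs; exact: oem_oplus.
rewrite -[in k a](hs a) -[in k c](hs c) !kh; exact: oem_oplus.
Qed.

Lemma lift_mul a b : k (emul a b) = emul (k a : N) (k b : N).
Proof.
by rewrite -[in LHS](hs a) -[in LHS](hs b) -oem_mul kh oem_mul -!kh !hs.
Qed.

Lemma lift_normal : @omega_normal (ea_poset M) (ea_poset N) k.
Proof.
move=> x y xI xy.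
have sxI : increasing_seq (s \o x) by move=> m n mn; apply/bpos_homo/xI.
have [z sz] := ea_omega_complete _ sxI.
have hsx : (h : B -> M) \o (s \o x) = x by apply/funext => i; exact: hs.
have lsx : (l : B -> N) \o (s \o x) = k \o x.
  by apply/funext => i; rewrite /= -kh hs.
have /[!hsx] hz := oem_normal h sxI sz.
have /[!lsx] lz := oem_normal l sxI sz.
by rewrite (supremum_uniq xy hz) kh.
Qed.

Definition lift : oem_hom M N :=
  @OEMHom M N k (bpos_top k) lift_oplus lift_normal lift_mul.

End Lift.

(** * The structure carried by a split coequalizer *)

(** The maps [s] and [t] make [h] a split coequalizer of [f] and [g] in bounded
    posets; they need not be homomorphisms, but [f] and [g] are. An operation of [B] applied
    to some [b] has the same image under [h] as when applied to [s (h b)]: write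
    [b] as [f (t b)], do the operation in [A] on [t b], and exchange [f] for
    [g], since [g (t b)] is [s (h b)]. So the operations, and with them the
    equations that hold in [B], descend to [P]. *)
Section SplitQuotient.
Variables (A B : omegaEffectMonoidType) (f g : oem_hom A B) (P : bposType).
Variables (h : bpos_hom (ea_poset B) P) (s : bpos_hom P (ea_poset B)).
Variable t : bpos_hom (ea_poset B) (ea_poset A).
Hypothesis hfg : forall a : A, h (f a) = h (g a).
Hypothesis hs : forall p, h (s p) = p.
Hypothesis ft : forall b : B, f (t b) = b.
Hypothesis gt : forall b : B, g (t b) = s (h b).
Implicit Types (a b c d : B) (p q r u : P).

(** The difference of [c] and [a] descends along [h]; only the bound [a <= c]
    has to be transported by [t]. *)
Lemma quot_oplus a b c : oplus a b = Some c ->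
  exists2 b', oplus (s (h a) : B) b' = Some (s (h c) : B) & h b' = h b.
Proof.
move=> ab; have /ea_leP[d td] : t a <= t c by apply/bpos_homo/ea_leP; exists b.
have /(oplus_cancel ab) -> : oplus a (f d) = Some c.
  by rewrite -{1}[a]ft -[c]ft; exact: oem_oplus.
by exists (g d); rewrite -?gt ?hfg //; exact: oem_oplus.
Qed.

Lemma quot_mul a b : h (emul a b) = h (emul (s (h a) : B) (s (h b) : B)).
Proof. by rewrite -{1}[a]ft -{1}[b]ft -oem_mul hfg oem_mul !gt. Qed.

(** A sum in [P] is the image of a sum in [B]. As a relation this is symmetric
    by construction, whereas the formula through [s] of [qplus_lift] depends on
    the order of the summands. *)
Definition qplus p q u :=
  exists a b c, [/\ oplus a b = Some c, h a = p, h b = q & h c = u].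

Lemma qplus_lift p q u : qplus p q u ->
  exists2 b, oplus (s p : B) b = Some (s u : B) & h b = q.
Proof. by move=> [a [b [c [/quot_oplus[b' ab' b'b] <- <- <-]]]]; exists b'. Qed.

Lemma qplusC p q u : qplus p q u -> qplus q p u.
Proof. by move=> [a [b [c [/oplusC ab <- <- <-]]]]; exists b, a, c. Qed.

Definition qorth p : P := h (orth (s p : B)).

Lemma qplus_orth_sum p q u : qplus p q u -> qplus p (qorth u) (qorth q).
Proof.
move=> /qplusC/qplus_lift[b]/oplusC/oplus_orth_sum sb <-.
by exists b, (orth (s u : B)), (orth (s q : B)).
Qed.

Lemma qplus_cancel p q q' u : qplus p q u -> qplus p q' u -> q = q'.
Proof.
move=> /qplus_lift[b sb <-] /qplus_lift[b' sb' <-].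
by rewrite (oplus_cancel sb sb').
Qed.

Lemma qorth_inj : injective qorth.
Proof.
have orthP p : qplus p (qorth p) \top.
  exists (s p), (orth (s p : B)), eone.
  by rewrite oplus_orth hs (bpos_top h).
move=> p q e; apply: (@qplus_cancel (qorth p)); apply: qplusC.
  exact: orthP.
rewrite e; exact: orthP.
Qed.

(** The sum is the orthosupplement of a difference, and differences are unique
    by [qplus_cancel]. *)
Lemma qplus_fun p q u u' : qplus p q u -> qplus p q u' -> u = u'.
Proof.
move=> /qplus_orth_sum pu /qplus_orth_sum pu'.
exact/qorth_inj/(qplus_cancel pu pu').
Qed.

Definition qoplus p q : option P :=
  if pselect (exists u, qplus p q u) is left e then Some (sval (cid e))
  else None.

Lemma qoplusE p q u : qoplus p q = Some u <-> qplus p q u.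
Proof.
rewrite /qoplus; case: pselect => [e|ne]; last first.
  by split=> // pqu; case: ne; exists u.
case: cid => v pqv /=; split=> [[<-] //|pqu].
by rewrite (qplus_fun pqu pqv).
Qed.

Definition qmul p q : P := h (emul (s p : B) (s q : B)).

Lemma qorth0 : qorth \bot = \top.
Proof. by rewrite /qorth (bpos_bot s); exact: (bpos_top h). Qed.

Lemma section_top : s \top = eone :> B.
Proof. exact: (bpos_top s). Qed.

Fact qoplusC p q u : qoplus p q = Some u -> qoplus q p = Some u.
Proof. by move=> /qoplusE/qplusC/qoplusE. Qed.

Fact qoplus0 p : qoplus p \bot = Some p.
Proof.
apply/qoplusE; exists (s p), ezero, (s p).
by rewrite oplus0 hs (bpos_bot h).
Qed.

Fact qoplusA p q r u v : qoplus p q = Some u -> qoplus u r = Some v ->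
  exists2 w, qoplus q r = Some w & qoplus p w = Some v.
Proof.
move=> /qoplusE/qplus_lift[b pb <-] /qoplusE/qplus_lift[c uc <-].
have [d bc pd] := oplusA pb uc.
exists (h d); apply/qoplusE; first by exists b, c, d.
by exists (s p), d, (s v); rewrite !hs.
Qed.

Fact qoplus_orth p : qoplus p (qorth p) = Some (qorth \bot).
Proof.
apply/qoplusE; exists (s p), (orth (s p : B)), eone.
by rewrite oplus_orth hs qorth0 (bpos_top h).
Qed.

Fact qorth_uniq p q : qoplus p q = Some (qorth \bot) -> q = qorth p.
Proof.
by move=> /qoplusE pq; apply: (qplus_cancel pq); apply/qoplusE/qoplus_orth.
Qed.

Fact qoplus1 p : qoplus p (qorth \bot) -> p = \bot.
Proof.
case e: qoplus => [u|//] _; move: e => /qoplusE/qplusC/qplus_lift[b].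
rewrite qorth0 section_top => /oplusC b1 <-.
by rewrite (@oplus1 _ b) ?b1 // (bpos_bot h).
Qed.

(** The structures are packed on the carrier of [P] itself rather than declared
    as instances, as they depend on the splitting and not on [P] alone. *)
Definition quot_ea : effectAlgebraType := HB.pack_for effectAlgebraType
  (P : Type) (isEffectAlgebra.Build (P : Type)
    qoplusC qoplus0 qoplusA qoplus_orth qorth_uniq qoplus1).

Lemma quot_leE p q :
  ((p : ea_poset quot_ea) <= (q : ea_poset quot_ea)) = (p <= q).
Proof.
apply/ea_leP/idP => [[r /qoplusE[a [b [c [ab <- _ <-]]]]]|pq].
  by apply/bpos_homo/ea_leP; exists b.
have /ea_leP[b sb] : s p <= s q by exact/bpos_homo.
by exists (h b); apply/qoplusE; exists (s p), b, (s q); rewrite !hs.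
Qed.

Fact qmulA p q r : qmul p (qmul q r) = qmul (qmul p q) r.
Proof. by rewrite /qmul -{1}(hs p) -quot_mul emulA quot_mul hs. Qed.

Fact qmulr1 p : qmul p (eone : quot_ea) = p.
Proof. by rewrite /qmul [eone]qorth0 section_top emulr1 hs. Qed.

Fact qmul1r p : qmul (eone : quot_ea) p = p.
Proof. by rewrite /qmul [eone]qorth0 section_top emul1r hs. Qed.

Fact qmulDr p q r u : oplus (q : quot_ea) r = Some u ->
  oplus (qmul p q : quot_ea) (qmul p r) = Some (qmul p u).
Proof.
move=> /qoplusE/qplus_lift[b qb <-]; apply/qoplusE.
exists (emul (s p : B) (s q)), (emul (s p : B) b), (emul (s p : B) (s u)).
by rewrite (emulDr _ qb) (quot_mul (s p) b) hs.
Qed.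

Fact qmulDl p q r u : oplus (q : quot_ea) r = Some u ->
  oplus (qmul q p : quot_ea) (qmul r p) = Some (qmul u p).
Proof.
move=> /qoplusE/qplus_lift[b qb <-]; apply/qoplusE.
exists (emul (s q : B) (s p)), (emul b (s p : B)), (emul (s u : B) (s p)).
by rewrite (emulDl _ qb) (quot_mul b (s p)) hs.
Qed.

Definition quot_em : effectMonoidType := HB.pack_for effectMonoidType
  (P : Type) (EffectAlgebra.class quot_ea)
  (EffectAlgebra_isEffectMonoid.Build quot_ea
    qmulA qmulr1 qmul1r qmulDr qmulDl).

Lemma quot_sup (x : nat -> P) (y : B) : increasing_seq x ->
  supremums (range (s \o x)) y -> supremums (range x) (h y).
Proof.
move=> xI /supremum_rangeP[yu yl]; apply/supremum_rangeP; split=> [i|u xu].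
  by rewrite -[x i]hs; exact/bpos_homo/yu.
by rewrite -[u]hs; apply/bpos_homo/yl => i; exact/bpos_homo/xu.
Qed.

Lemma quot_supremums (x : nat -> P) (y : P) :
  supremums (range (x : nat -> ea_poset quot_em)) (y : ea_poset quot_em) <->
  supremums (range x) y.
Proof.
split=> /supremum_rangeP[xu xl]; apply/supremum_rangeP; split=> [i|u hu].
- by rewrite -quot_leE; exact: xu.
- by rewrite -quot_leE; apply: xl => i; rewrite quot_leE.
- by rewrite quot_leE; exact: xu.
- by rewrite quot_leE; apply: xl => i; rewrite -quot_leE; apply: hu.
Qed.

Fact quot_omega_complete : omega_complete (ea_poset quot_em).
Proof.
move=> x xI.
have xI' : increasing_seq (x : nat -> P).
  by move=> m n /xI; rewrite quot_leE.
have sxI : increasing_seq (s \o x) by move=> m n mn; apply/bpos_homo/xI'.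
have [z sz] := ea_omega_complete _ sxI.
by exists (h z); apply/quot_supremums/quot_sup.
Qed.

Definition quot_oem : omegaEffectMonoidType := HB.pack_for omegaEffectMonoidType
  (P : Type) (EffectMonoid.class quot_em)
  (EffectMonoid_isOmega.Build quot_em quot_omega_complete).

Lemma quot_normal : @omega_normal (ea_poset B) (ea_poset quot_oem) h.
Proof.
move=> x y xI xy; apply/(quot_supremums (h \o x)).
have txI : increasing_seq (t \o x) by move=> m n mn; apply/bpos_homo/xI.
have [z tz] := ea_omega_complete _ txI.
have ftx : (f : A -> B) \o (t \o x) = x by apply/funext => i; exact: ft.
have gtx : (g : A -> B) \o (t \o x) = s \o (h \o x).
  by apply/funext => i; exact: gt.
have /[!ftx] fz := oem_normal f txI tz.
have /[!gtx] gz := oem_normal g txI tz.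
rewrite (supremum_uniq xy fz) hfg; apply: quot_sup gz.
by move=> m n /xI/(bpos_homo h).
Qed.

Definition quot_map : oem_hom B quot_oem.
Proof.
refine (@OEMHom B quot_oem h _ _ quot_normal quot_mul).
  by rewrite [RHS]qorth0; exact: (bpos_top h).
by move=> a b c ab; apply/qoplusE; exists a, b, c.
Defined.

Definition quot_iso : bpos_hom (ea_poset quot_oem) P.
Proof.
refine (@BPosHom (ea_poset quot_oem) P (id : P -> P) _ _ _) => //.
  by move=> p q; rewrite -quot_leE.
exact: qorth0.
Defined.

Definition quot_iso_inv : bpos_hom P (ea_poset quot_oem).
Proof.
refine (@BPosHom P (ea_poset quot_oem) (id : P -> P) _ _ _) => //.
  by move=> p q; rewrite -quot_leE.
exact/esym/qorth0.
Defined.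

End SplitQuotient.

(** * The free omega-effect monoid on a bounded poset *)

Section FreeObject.
Variable P : bposType.
Implicit Types M N : omegaEffectMonoidType.

(** Zero is the variable of the bottom element, which every map of bounded
    posets sends to zero. *)
Inductive term : Type :=
| Var of P
| Orth of term
| Plus of term & term
| Mul of term & term
| Sup of (nat -> term).

(** Evaluation is a relation because the sum may be undefined and the sequence
    under [Sup] need not increase. A default value in these cases would not be
    preserved by homomorphisms, and [eval_oem] would fail. *)
Fixpoint eval (M : omegaEffectMonoidType) (f : bpos_hom P (ea_poset M))
    (t : term) (m : M) : Prop :=
  match t with
  | Var p => m = f p
  | Orth t => exists2 a, eval f t a & m = orth a
  | Plus t u => exists a b, [/\ eval f t a, eval f u b & oplus a b = Some m]
  | Mul t u => exists a b, [/\ eval f t a, eval f u b & m = emul a b]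
  | Sup t => exists x : nat -> ea_poset M,
      [/\ forall i, eval f (t i) (x i), increasing_seq x
        & supremums (range x) m]
  end.

Lemma eval_fun M (f : bpos_hom P (ea_poset M)) t m m' :
  eval f t m -> eval f t m' -> m = m'.
Proof.
elim: t m m' => [p|t IH|t IHt u IHu|t IHt u IHu|t IH] m m' /=.
- by move=> -> ->.
- by move=> [a ta ->] [b tb ->]; rewrite (IH a b).
- move=> [a [b [ta ub ab]]] [a' [b' [ta' ub']]].
  by rewrite -(IHt _ _ ta ta') -(IHu _ _ ub ub') ab => -[].
- move=> [a [b [ta ub ->]]] [a' [b' [ta' ub' ->]]].
  by rewrite -(IHt _ _ ta ta') -(IHu _ _ ub ub').
- move=> [x [tx _ xm]] [y [ty _ ym]]; apply: (supremum_uniq xm).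
  by rewrite (_ : x = y) //; apply/funext => i; exact: IH (tx i) (ty i).
Qed.

Lemma eval_oem M N (f : bpos_hom P (ea_poset M))
    (f' : bpos_hom P (ea_poset N)) (g : oem_hom M N) t m :
  (forall p, g (f p) = f' p) -> eval f t m -> eval f' t (g m).
Proof.
move=> gf; elim: t m => [p|t IH|t IHt u IHu|t IHt u IHu|t IH] m /=.
- by move=> ->.
- by move=> [a /IH ta ->]; exists (g a) => //; exact: oem_orth.
- move=> [a [b [/IHt ta /IHu ub ab]]]; exists (g a), (g b).
  by split=> //; exact: oem_oplus.
- move=> [a [b [/IHt ta /IHu ub ->]]]; exists (g a), (g b).
  by split=> //; exact: oem_mul.
- move=> [x [tx xI xm]]; exists ((g : M -> N) \o x); split.
  + by move=> i; exact: IH.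
  + by move=> i j ij; apply/oem_homo/xI.
  + exact: oem_normal xI xm.
Qed.

Definition defined (t : term) : Prop :=
  forall (M : omegaEffectMonoidType) (f : bpos_hom P (ea_poset M)),
    exists m : M, eval f t m.

Definition dterm := {t : term | defined t}.

HB.instance Definition _ := gen_eqMixin dterm.
HB.instance Definition _ := gen_choiceMixin dterm.

Definition value (t : dterm) M (f : bpos_hom P (ea_poset M)) : M :=
  sval (cid (svalP t M f)).

Lemma valueP t M (f : bpos_hom P (ea_poset M)) :
  eval f (sval t) (@value t M f).
Proof. by rewrite /value; case: cid. Qed.

Definition term_equiv (t u : dterm) : bool :=
  `[< forall M f, @value t M f = @value u M f >].

Fact term_equiv_refl : reflexive term_equiv.
Proof. by move=> t; apply/asboolP. Qed.

Fact term_equiv_sym : symmetric term_equiv.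
Proof. by move=> t u; apply/asboolP/asboolP => e M f. Qed.

Fact term_equiv_trans : transitive term_equiv.
Proof.
by move=> u t v /asboolP tu /asboolP uv; apply/asboolP => M f; rewrite tu uv.
Qed.

Definition term_equiv_rel :=
  EquivRel term_equiv term_equiv_refl term_equiv_sym term_equiv_trans.

Definition free : Type := {eq_quot term_equiv_rel}%qT.

Definition proj M (f : bpos_hom P (ea_poset M)) (x : free) : M :=
  value (repr (x : {eq_quot term_equiv_rel}%qT)) f.

(** The projections represent [free] inside the product of all omega-effect
    monoids under [P], a product too large to be formed; this lemma and
    [free_elt] reduce each property of [free] to its instances there. *)
Lemma proj_inj (x y : free) : (forall M f, @proj M f x = @proj M f y) -> x = y.
Proof.
move=> xy; rewrite -[x](@reprK _ {eq_quot term_equiv_rel}%qT).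
rewrite -[y](@reprK _ {eq_quot term_equiv_rel}%qT).
by apply/eqmodP/asboolP.
Qed.

Definition class (t : dterm) : free := (\pi_({eq_quot term_equiv_rel}) t)%qT.

Lemma proj_class t M (f : bpos_hom P (ea_poset M)) :
  proj f (class t) = value t f.
Proof.
have /eqmodP/asboolP := @reprK _ {eq_quot term_equiv_rel}%qT (class t).
exact.
Qed.

Definition code (x : free) : term :=
  sval (repr (x : {eq_quot term_equiv_rel}%qT)).

Lemma codeP (x : free) M (f : bpos_hom P (ea_poset M)) :
  eval f (code x) (proj f x).
Proof. exact: valueP. Qed.

Lemma free_elt t
    (v : forall M : omegaEffectMonoidType, bpos_hom P (ea_poset M) -> M) :
  (forall M f, eval f t (v M f)) ->
  exists x, forall M f, @proj M f x = v M f.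
Proof.
move=> tv; have td : defined t by move=> M f; exists (v M f).
exists (class (exist _ t td)) => M f; rewrite proj_class.
exact: (eval_fun (valueP (exist _ t td) f) (tv M f)).
Qed.

Fact free_zero_ex : exists z : free, forall M f, @proj M f z = ezero.
Proof. by apply: (@free_elt (Var \bot)) => M f; exact/esym/(bpos_bot f). Qed.

Fact free_orth_ex (x : free) :
  exists z : free, forall M f, @proj M f z = orth (proj f x).
Proof.
apply: (@free_elt (Orth (code x))) => M f.
by exists (proj f x) => //; exact: codeP.
Qed.

Fact free_mul_ex (x y : free) :
  exists z : free, forall M f, @proj M f z = emul (proj f x) (proj f y).
Proof.
apply: (@free_elt (Mul (code x) (code y))) => M f.
by exists (proj f x), (proj f y); split=> //; exact: codeP.
Qed.

Lemma free_plus_ex (x y : free) :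
  (forall M f, exists m, oplus (@proj M f x) (proj f y) = Some m) ->
  exists z : free, forall M f, oplus (@proj M f x) (proj f y) = Some (proj f z).
Proof.
move=> xy.
have [|z zP] := @free_elt (Plus (code x) (code y))
  (fun M f => sval (cid (xy M f))).
  move=> M f; exists (proj f x), (proj f y).
  by split; [exact: codeP|exact: codeP|exact: svalP (cid (xy M f))].
by exists z => M f; rewrite zP; exact: svalP (cid (xy M f)).
Qed.

Lemma free_sup_ex (x : nat -> free) :
  (forall M f, increasing_seq (fun i => @proj M f (x i) : ea_poset M)) ->
  exists z : free, forall M f,
    supremums (range (fun i => @proj M f (x i) : ea_poset M)) (proj f z).
Proof.
move=> xI; have sP M f := ea_omega_complete _ (xI M f).
have [|z zP] := @free_elt (Sup (code \o x)) (fun M f => sval (cid (sP M f))).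
  move=> M f; exists (fun i => proj f (x i)).
  by split; [move=> i; exact: codeP|exact: xI|exact: svalP (cid (sP M f))].
by exists z => M f; rewrite zP; exact: svalP (cid (sP M f)).
Qed.

Definition free_zero : free := sval (cid free_zero_ex).
Definition free_orth (x : free) : free := sval (cid (free_orth_ex x)).
Definition free_mul (x y : free) : free := sval (cid (free_mul_ex x y)).
Definition free_plus (x y : free) : option free :=
  if pselect (exists z : free, forall M f,
    oplus (@proj M f x) (proj f y) = Some (proj f z)) is left e then
    Some (sval (cid e))
  else None.

Lemma proj_zero M f : @proj M f free_zero = ezero.
Proof. exact: svalP (cid free_zero_ex) M f. Qed.

Lemma proj_orth M f x : @proj M f (free_orth x) = orth (proj f x).
Proof. exact: svalP (cid (free_orth_ex x)) M f. Qed.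

Lemma proj_mul M f x y : @proj M f (free_mul x y) = emul (proj f x) (proj f y).
Proof. exact: svalP (cid (free_mul_ex x y)) M f. Qed.

Lemma free_plusP x y z : free_plus x y = Some z <->
  forall M f, oplus (@proj M f x) (proj f y) = Some (proj f z).
Proof.
rewrite /free_plus; case: pselect => [e|ne]; last first.
  by split=> // xyz; case: ne; exists z.
case: cid => w wP /=; split=> [[<-] //|zP].
by congr Some; apply: proj_inj => M f; move: (wP M f); rewrite zP => -[].
Qed.

Fact free_plusC x y z : free_plus x y = Some z -> free_plus y x = Some z.
Proof. by move=> /free_plusP xyz; apply/free_plusP => M f; exact/oplusC. Qed.

Fact free_plus0 x : free_plus x free_zero = Some x.
Proof. by apply/free_plusP => M f; rewrite proj_zero oplus0. Qed.

Fact free_plusA x y z xy xyz :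
  free_plus x y = Some xy -> free_plus xy z = Some xyz ->
  exists2 yz, free_plus y z = Some yz & free_plus x yz = Some xyz.
Proof.
move=> /free_plusP h1 /free_plusP h2.
have [|w wP] := @free_plus_ex y z.
  by move=> M f; have [m yz _] := oplusA (h1 M f) (h2 M f); exists m.
exists w; apply/free_plusP => // M f.
by have [m] := oplusA (h1 M f) (h2 M f); rewrite wP => -[->].
Qed.

Fact free_plus_orth x : free_plus x (free_orth x) = Some (free_orth free_zero).
Proof. by apply/free_plusP => M f; rewrite !proj_orth proj_zero oplus_orth. Qed.

Fact free_orth_uniq x y :
  free_plus x y = Some (free_orth free_zero) -> y = free_orth x.
Proof.
move=> /free_plusP xy; apply: proj_inj => M f; rewrite proj_orth.
by apply: orth_uniq; rewrite xy proj_orth proj_zero.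
Qed.

Fact free_plus1 x : free_plus x (free_orth free_zero) -> x = free_zero.
Proof.
case e: free_plus => [z|//] _; move/free_plusP: e => xz.
apply: proj_inj => M f; rewrite proj_zero; apply: oplus1.
by have := xz M f; rewrite proj_orth proj_zero => ->.
Qed.

HB.instance Definition _ := isEffectAlgebra.Build free
  free_plusC free_plus0 free_plusA free_plus_orth free_orth_uniq free_plus1.

Lemma proj_one M f : @proj M f eone = eone.
Proof. by rewrite proj_orth proj_zero. Qed.

Fact free_mulA x y z : free_mul x (free_mul y z) = free_mul (free_mul x y) z.
Proof. by apply: proj_inj => M f; rewrite !proj_mul emulA. Qed.

Fact free_mulr1 x : free_mul x eone = x.
Proof. by apply: proj_inj => M f; rewrite proj_mul proj_one emulr1. Qed.

Fact free_mul1r x : free_mul eone x = x.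
Proof. by apply: proj_inj => M f; rewrite proj_mul proj_one emul1r. Qed.

Fact free_mulDr x y z s : oplus y z = Some s ->
  oplus (free_mul x y) (free_mul x z) = Some (free_mul x s).
Proof.
move=> /free_plusP yz; apply/free_plusP => M f.
by rewrite !proj_mul; exact: emulDr (yz M f).
Qed.

Fact free_mulDl x y z s : oplus y z = Some s ->
  oplus (free_mul y x) (free_mul z x) = Some (free_mul s x).
Proof.
move=> /free_plusP yz; apply/free_plusP => M f.
by rewrite !proj_mul; exact: emulDl (yz M f).
Qed.

HB.instance Definition _ := EffectAlgebra_isEffectMonoid.Build free
  free_mulA free_mulr1 free_mul1r free_mulDr free_mulDl.

(** If [x <= y] pointwise, the difference is itself the value of a term: it is
    the orthosupplement of the sum of [x] and [free_orth y]. *)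
Lemma free_leP (x y : ea_poset free) : x <= y <->
  forall M f, (@proj M f x : ea_poset M) <= proj f y.
Proof.
split=> [/ea_leP[z /free_plusP xz] M f|xy].
  by apply/ea_leP; exists (proj f z).
have [|w wP] := @free_plus_ex x (free_orth y).
  move=> M f; have /ea_leP[c xc] := xy M f.
  by exists (orth c); rewrite proj_orth; exact: oplus_orth_sum.
apply/ea_leP; exists (free_orth w); apply/free_plusP => M f.
have := oplus_orth_sum (wP M f).
by rewrite !proj_orth orthK.
Qed.

Lemma free_sup_pointwise (x : nat -> ea_poset free) : increasing_seq x ->
  exists2 z : ea_poset free, supremums (range x) z &
    forall M f,
      supremums (range (fun i => @proj M f (x i) : ea_poset M)) (proj f z).
Proof.
move=> xI; have [|z zP] := @free_sup_ex x.
  by move=> M f i j /xI/free_leP; apply.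
exists z => //; apply/supremum_rangeP; split=> [i|u xu]; apply/free_leP => M f;
  have /supremum_rangeP[zu zl] := zP M f; first exact: zu.
by apply: zl => i; move/free_leP: (xu i); apply.
Qed.

Fact free_omega_complete : omega_complete (ea_poset free).
Proof. by move=> x /free_sup_pointwise[z xz _]; exists z. Qed.

HB.instance Definition _ := EffectMonoid_isOmega.Build free free_omega_complete.

Definition free_ext (M : omegaEffectMonoidType) (f : bpos_hom P (ea_poset M)) :
  oem_hom free M.
Proof.
refine (@OEMHom free M (proj f) (proj_one f) _ _ _).
- by move=> x y z /free_plusP.
- move=> x z xI xz; have [w xw wP] := free_sup_pointwise xI.
  by rewrite (supremum_uniq xz xw); exact: wP.
- by move=> x y; rewrite proj_mul.
Defined.

Fact free_var_ex p : exists z : free, forall M f, @proj M f z = f p.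
Proof. exact: (@free_elt (Var p)). Qed.

Definition free_var p : free := sval (cid (free_var_ex p)).

Lemma proj_var M f p : @proj M f (free_var p) = f p.
Proof. exact: svalP (cid (free_var_ex p)) M f. Qed.

Definition free_eta : bpos_hom P (ea_poset free).
Proof.
refine (@BPosHom P (ea_poset free) free_var _ _ _).
- by move=> p q pq; apply/free_leP => M f; rewrite !proj_var; exact/bpos_homo.
- by apply: proj_inj => M f; rewrite proj_var proj_zero; exact: (bpos_bot f).
- by apply: proj_inj => M f; rewrite proj_var proj_one; exact: (bpos_top f).
Defined.

(** A homomorphism [g] on [free] is determined on [x] by the value of its code
    at [free_eta], which is [x] itself: evaluation along [free_eta] makes sense
    because [free] is one of the omega-effect monoids over which the terms were
    required to be defined, and every projection carries the resulting value to
    the projection of [x]. *)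
Lemma free_ext_uniq (M : omegaEffectMonoidType) (f : bpos_hom P (ea_poset M))
    (g : oem_hom free M) :
  (forall p, g (free_eta p) = f p) -> forall x, g x = proj f x.
Proof.
move=> gf x.
have codex : eval free_eta (code x) x.
  suff e : x = proj free_eta x by rewrite {2}e; exact: codeP.
  apply: proj_inj => N k; apply: (eval_fun (codeP x k)).
  apply: (eval_oem (g := free_ext k) _ (codeP x free_eta)) => p.
  exact: proj_var.
exact: eval_fun (eval_oem gf codex) (codeP x f).
Qed.

End FreeObject.

(** * Monadicity of the forgetful functor *)

Definition free_oem (P : BPos) : omegaEM := free P.

Definition free_arrow (P : BPos) : hom P (underlying (free_oem P)) :=
  free_eta P.

Definition free_hom (P : BPos) (M : omegaEM) (f : hom P (underlying M)) :
  hom (free_oem P) M := free_ext f.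

Lemma free_homK (P : BPos) (M : omegaEM) (f : hom P (underlying M)) :
  fmap underlying (free_hom f) ∘ free_arrow P = f.
Proof. by apply/bpos_hom_eq/funext => p; exact: proj_var. Qed.

Lemma free_hom_inj (P : BPos) (M : omegaEM) (g h : hom (free_oem P) M) :
  fmap underlying g ∘ free_arrow P = fmap underlying h ∘ free_arrow P ->
  g = h.
Proof.
move=> gh; apply/oem_hom_eq/funext => x.
rewrite [LHS](@free_ext_uniq _ _ (fmap underlying h ∘ free_arrow P)) //.
  by rewrite [RHS](@free_ext_uniq _ _ (fmap underlying h ∘ free_arrow P)).
by move=> p; exact: (congr1 (fun k : bpos_hom P (ea_poset M) => k p) gh).
Qed.

Lemma underlying_faithful (M N : omegaEM) (g h : hom M N) :
  fmap underlying g = fmap underlying h -> g = h.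
Proof.
by move=> gh; apply/oem_hom_eq; exact: (congr1 (@bpos_fun _ _) gh).
Qed.

Lemma underlying_lift (B M N : omegaEM) (h : hom B M)
    (s : hom (underlying M) (underlying B))
    (k : hom (underlying M) (underlying N)) (l : hom B N) :
  fmap underlying h ∘ s = idm (underlying M) ->
  k ∘ fmap underlying h = fmap underlying l ->
  exists k' : hom M N, fmap underlying k' = k.
Proof.
move=> hs kh.
have hs' x : h (s x) = x.
  exact: (congr1 (fun k : bpos_hom (ea_poset M) (ea_poset M) => k x) hs).
have kh' b : k (h b) = l b.
  exact: (congr1 (fun k : bpos_hom (ea_poset B) (ea_poset N) => k b) kh).
by exists (lift hs' kh'); exact: bpos_hom_eq.
Qed.

Definition free_oem_monad : monad BPos :=
  free_monad free_homK free_hom_inj.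

(** The structure map [h] of an algebra on [P] is the split coequalizer, in
    bounded posets, of the counit and of the image of [h] under the free
    functor; the universal arrows are the splittings. *)
Lemma algebra_structure (A : em_algebra free_oem_monad) :
  exists (M : omegaEM) (q : hom (free_oem (em_car A)) M)
    (i : hom (underlying M) (em_car A)),
    is_iso i /\ i ∘ fmap underlying q = em_str A.
Proof.
case: A => P h hu hm /=; set T := free_oem_monad in h hu hm *.
pose s : hom P (T P) := free_arrow P.
pose t : hom (T P) (T (T P)) := free_arrow (T P).
pose f : hom (free_oem (T P)) (free_oem P) := counit free_hom (free_oem P).
pose g : hom (free_oem (T P)) (free_oem P) := free_map free_arrow free_hom h.
have hfg a : h (f a) = h (g a).
  exact: (congr1 (fun k : bpos_hom (T (T P)) P => k a) (esym hm)).
have hs p : h (s p) = p.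
  exact: (congr1 (fun k : bpos_hom P P => k p) hu).
have ft b : f (t b) = b.
  exact: (congr1 (fun k : bpos_hom (T P) (T P) => k b)
    (counit_eta free_homK (free_oem P))).
have gt b : g (t b) = s (h b).
  exact: (congr1 (fun k : bpos_hom (T P) (T P) => k b)
    (free_homK (s ∘ h))).
exists (quot_oem hfg hs ft gt), (quot_map hfg hs ft gt).
exists (quot_iso hfg hs ft gt).
split; last exact: bpos_hom_eq.
by exists (quot_iso_inv hfg hs ft gt); split; exact: bpos_hom_eq.
Qed.

Theorem theorem38 :
  exists T : monad BPos, equivalent omegaEM (EilenbergMoore T).
Proof.
exists free_oem_monad.
exact: monadicity underlying_faithful underlying_lift algebra_structure.
Qed.
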